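(* Let $(A,[\ ,\ ]_A,\cdot_A,\delta_r,\Delta_r)$ be a factorizable Poisson bialgebra, with $r\in A\otimes A$. Define operations on $A^*$ by $$[x^*,y^*]_r=-\mathrm{ad}^*(r_+(x^* ))y^*+\mathrm{ad}^*(r_-(y^* ))x^*,\qquad x^*\cdot_r y^*=L^*(r_+(x^* ))y^*+L^*(r_-(y^* ))x^*,\qquad x^*,y^*\in A^*.$$ Then $\mathrm{Im}(r_+\oplus r_-)=\{(r_+(x^* ),r_-(x^* )) : x^*\in A^*\}$ is a Poisson subalgebra of the direct sum Poisson algebra $A\oplus A$, and it is isomorphic to the Poisson algebra $(A^*,[\ ,\ ]_r,\cdot_r)$. Moreover, every $a\in A$ has a unique decomposition $a=a_+-a_-$ with $(a_+,a_-)\in \mathrm{Im}(r_+\oplus r_-)$.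
   Context: All vector spaces are finite-dimensional over a field $\mathbb K$ of characteristic $0$; algebras need not be unital. A Poisson algebra $(A,[\ ,\ ]_A,\cdot_A)$ is a Lie algebra $(A,[\ ,\ ]_A)$ and a commutative associative algebra $(A,\cdot_A)$ on the same space with $[a,b\cdot_A c]_A=[a,b]_A\cdot_A c+b\cdot_A[a,c]_A$. Write $\mathrm{ad}(a)b=[a,b]_A$, $L(a)b=a\cdot_A b$, and $\mathrm{ad}^*(a)=(\mathrm{ad}(a))^*$, $L^*(a)=(L(a))^*$ for the transposed maps on $A^*$ (no sign). Poisson bialgebra: a Poisson algebra with linear maps $\delta,\Delta:A\to A\otimes A$ such that the dual operations $\langle[x^*,y^*]_{A^*},a\rangle=\langle\delta(a),x^*\otimes y^*\rangle$, $\langle x^*\cdot_{A^*}y^*,a\rangle=\langle\Delta(a),x^*\otimes y^*\rangle$ make $A^*$ a Poisson algebra and, for all $a,b\in A$: $\delta([a,b]_A)=(\mathrm{ad}(a)\otimes\mathrm{id}+\mathrm{id}\otimes\mathrm{ad}(a))\delta(b)-(\mathrm{ad}(b)\otimes\mathrm{id}+\mathrm{id}\otimes\mathrm{ad}(b))\delta(a)$; $\Delta(a\cdot_A b)=(L(a)\otimes\mathrm{id})\Delta(b)+(\mathrm{id}\otimes L(b))\Delta(a)$; $\delta(a\cdot_A b)=(L(a)\otimes\mathrm{id})\delta(b)+(L(b)\otimes\mathrm{id})\delta(a)+(\mathrm{id}\otimes\mathrm{ad}(a))\Delta(b)+(\mathrm{id}\otimes\mathrm{ad}(b))\Delta(a)$;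 $\Delta([a,b]_A)=(\mathrm{ad}(a)\otimes\mathrm{id}+\mathrm{id}\otimes\mathrm{ad}(a))\Delta(b)+(L(b)\otimes\mathrm{id}-\mathrm{id}\otimes L(b))\delta(a)$. For $r=\sum_i a_i\otimes b_i\in A\otimes A$ put $\delta_r(a)=(\mathrm{id}\otimes\mathrm{ad}(a)+\mathrm{ad}(a)\otimes\mathrm{id})(r)$, $\Delta_r(a)=(\mathrm{id}\otimes L(a)-L(a)\otimes\mathrm{id})(r)$. $r$ is a solution of the Poisson Yang-Baxter equation if $\mathbf C(r)=\mathbf A(r)=0$, where $\mathbf C(r)=\sum_{i,j}([a_i,a_j]_A\otimes b_i\otimes b_j+a_i\otimes a_j\otimes[b_i,b_j]_A+a_i\otimes[b_i,a_j]_A\otimes b_j)$, $\mathbf A(r)=\sum_{i,j}(a_i\cdot_A a_j\otimes b_i\otimes b_j+a_i\otimes a_j\otimes b_i\cdot_A b_j-a_i\otimes a_j\cdot_A b_i\otimes b_j)$. A tensor $s\in A\otimes A$ is $(\mathrm{ad},L)$-invariant if $(\mathrm{ad}(a)\otimes\mathrm{id}+\mathrm{id}\otimes\mathrm{ad}(a))(s)=0$ and $(L(a)\otimes\mathrm{id}-\mathrm{id}\otimes L(a))(s)=0$ for all $a\in A$. If $r$ solves the Poisson Yang-Baxter equation and its symmetric part $\frac12(r+\tau(r))$ ($\tau$ the flip) is $(\mathrm{ad},L)$-invariant, then $(A,[\ ,\ ]_A,\cdot_A,\delta_r,\Delta_r)$ is a Poisson bialgebra (known), called quasi-triangular. The maps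 $r_\pm:A^*\to A$ are defined by $\langle r_+(x^* ),y^*\rangle=-\langle x^*,r_-(y^* )\rangle=\langle r,x^*\otimes y^*\rangle$, and $I_r=r_+-r_-$. A quasi-triangular Poisson bialgebra is factorizable if the symmetric part of $r$ is nondegenerate, i.e. $I_r:A^*\to A$ is a linear isomorphism. The operations dual to $\delta_r,\Delta_r$ are exactly $[\ ,\ ]_r,\cdot_r$. *)

(* Defs.v *)
From HB Require Import structures.
From mathcomp Require Import all_boot all_order all_algebra.

Set Implicit Arguments.
Unset Strict Implicit.
Unset Printing Implicit Defensive.

Import GRing.Theory.
Local Open Scope ring_scope.

(* The tensor product of U and V, as the matrices of coefficients on the      *)
(* basis e_i (x) f_j, where (e_i) and (f_j) are the bases vbasis {:U} and     *)
(* vbasis {:V}. Lemmas tliftE and tensor_ext give its universal property.     *)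
Definition tensor (K : fieldType) (U V : vectType K) :=
  'M[K]_(\dim {:U}, \dim {:V}).

Lemma linfunE (K : fieldType) (U V : vectType K) (f : U -> V) :
  linear f -> linfun f =1 f.
Proof.
move=> lf; exact: lfunE (HB.pack f (GRing.isLinear.Build _ _ _ _ f lf)).
Qed.

Lemma linfun_linear (K : fieldType) (U V W : vectType K) (f : U -> V -> W) :
  bilinear_for *:%R *:%R f -> linear (fun u => linfun (f u)).
Proof.
case=> fl fr c u v; apply/lfunP=> w; rewrite add_lfunE scale_lfunE.
by rewrite !linfunE ?fl.
Qed.

Section Tensor.
Context {K : fieldType}.
Implicit Types U V W : vectType K.

Definition pure U V (u : U) (v : V) : tensor U V :=
  \matrix_(i, j) (coord (vbasis {:U}) i u * coord (vbasis {:V}) j v).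

Lemma pure_bilinear U V : bilinear_for *:%R *:%R (@pure U V).
Proof.
split=> [v|u] c x y; apply/matrixP=> i j; rewrite !mxE linearP /=.
- by rewrite mulrDl mulrA.
- by rewrite mulrDr mulrCA.
Qed.

(* The linear map tensor U V -> W induced by a bilinear map U -> V -> W.      *)
Definition tlift U V W (f : U -> V -> W) (t : tensor U V) : W :=
  \sum_i \sum_j t i j *: f (vbasis {:U})`_i (vbasis {:V})`_j.

Lemma tlift_linear U V W (f : U -> V -> W) : linear (tlift f).
Proof.
move=> c s t; rewrite /tlift scaler_sumr -big_split /=; apply: eq_bigr => i _.
rewrite scaler_sumr -big_split /=; apply: eq_bigr => j _.
by rewrite !mxE scalerDl scalerA.
Qed.

HB.instance Definition _ U V W (f : U -> V -> W) :=
  GRing.isLinear.Build K (tensor U V) W *:%R (tlift f) (tlift_linear f).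

Lemma tliftE U V W (f : U -> V -> W) :
  bilinear_for *:%R *:%R f -> forall u v, tlift f (pure u v) = f u v.
Proof.
case=> fl fr u v.
pose gl y : {linear U -> W} :=
  HB.pack (f^~ y) (GRing.isLinear.Build _ _ _ _ (f^~ y) (fl y)).
pose gr x : {linear V -> W} :=
  HB.pack (f x) (GRing.isLinear.Build _ _ _ _ (f x) (fr x)).
rewrite {2}(coord_vbasis (memvf u)) -[f _ v]/(gl v _) linear_sum.
apply: eq_bigr => i _; rewrite linearZ /= {2}(coord_vbasis (memvf v)).
rewrite -[f _ (\sum_j _)]/(gr _ _) linear_sum scaler_sumr.
by apply: eq_bigr => j _; rewrite linearZ /= scalerA mxE.
Qed.

Lemma tlift_pure U V (t : tensor U V) : tlift (@pure U V) t = t.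
Proof.
have fU := basis_free (vbasisP {:U}); have fV := basis_free (vbasisP {:V}).
rewrite [RHS]matrix_sum_delta; apply: eq_bigr => i _; apply: eq_bigr => j _.
congr (_ *: _); apply/matrixP=> k l.
by rewrite !mxE !coord_free // -natrM mulnb (eq_sym i) (eq_sym j).
Qed.

Lemma tensor_ext U V W (f g : {linear tensor U V -> W}) :
  (forall u v, f (pure u v) = g (pure u v)) -> f =1 g.
Proof.
move=> fg t; rewrite -[t]tlift_pure !linear_sum; apply: eq_bigr => i _.
rewrite !linear_sum; apply: eq_bigr => j _; by rewrite !linearZ /= fg.
Qed.

Definition tmap U V U' V' (f : 'Hom(U, U')) (g : 'Hom(V, V'))
    : 'Hom(tensor U V, tensor U' V') :=
  linfun (tlift (fun u v => pure (f u) (g v))).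

Lemma tmapE U V U' V' (f : 'Hom(U, U')) (g : 'Hom(V, V')) u v :
  tmap f g (pure u v) = pure (f u) (g v).
Proof.
rewrite linfunE; last exact: tlift_linear.
have [pl pr] := pure_bilinear U' V'.
by rewrite tliftE //; split=> [y|y] c x z /=; rewrite linearP ?pl ?pr.
Qed.

Definition flip U V : tensor U V -> tensor V U := tlift (fun u v => pure v u).

Lemma tmap_linearl U V U' V' (g : 'Hom(V, V')) t :
  linear (fun f : 'Hom(U, U') => tmap f g t).
Proof.
move=> c f f'; rewrite !linfunE; do ?exact: tlift_linear.
have [pl _] := pure_bilinear U' V'.
rewrite /tlift scaler_sumr -big_split /=; apply: eq_bigr => i _.
rewrite scaler_sumr -big_split /=; apply: eq_bigr => j _.
rewrite add_lfunE scale_lfunE pl scalerDr; congr (_ + _).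
by rewrite [RHS]scalerA mulrC -scalerA.
Qed.

Lemma tmap_linearr U V U' V' (f : 'Hom(U, U')) t :
  linear (fun g : 'Hom(V, V') => tmap f g t).
Proof.
move=> c g g'; rewrite !linfunE; do ?exact: tlift_linear.
have [_ pr] := pure_bilinear U' V'.
rewrite /tlift scaler_sumr -big_split /=; apply: eq_bigr => i _.
rewrite scaler_sumr -big_split /=; apply: eq_bigr => j _.
rewrite add_lfunE scale_lfunE pr scalerDr; congr (_ + _).
by rewrite [RHS]scalerA mulrC -scalerA.
Qed.

Lemma tlift2_sum V W (g : V -> V -> V -> V -> W) n (a b : 'I_n -> V) :
    (forall u v, bilinear_for *:%R *:%R (g u v)) ->
    (forall u' v', bilinear_for *:%R *:%R (fun u v => g u v u' v')) ->
  let t := \sum_i pure (a i) (b i) in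
  tlift (fun u v => tlift (g u v) t) t
    = \sum_i \sum_j g (a i) (b i) (a j) (b j).
Proof.
move=> gr gl t; suff tE s :
    tlift (fun u v => tlift (g u v) s) t = \sum_i tlift (g (a i) (b i)) s.
  rewrite tE; apply: eq_bigr => i _.
  by rewrite linear_sum; apply: eq_bigr => j _; rewrite /= tliftE.
rewrite linear_sum; apply: eq_bigr => i _.
rewrite /= tliftE //; split=> [v|u] c x y /=;
  rewrite /tlift scaler_sumr -big_split /=;
    apply: eq_bigr => k _; rewrite scaler_sumr -big_split /=;
    apply: eq_bigr => l _; have [hl hr] := gl (vbasis {:V})`_k (vbasis {:V})`_l.
    by rewrite hl scalerDr !scalerA mulrC.
by rewrite hr scalerDr !scalerA mulrC.
Qed.

Lemma flip_linear U V : linear (@flip U V).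
Proof. exact: tlift_linear. Qed.

Lemma flipE U V (u : U) (v : V) : flip (pure u v) = pure v u.
Proof.
have [pl pr] := pure_bilinear V U.
by rewrite /flip tliftE //; split=> y c x z /=; rewrite ?pl ?pr.
Qed.

Definition dual V : vectType K := 'Hom(V, K^o).

(* The transposed map, without sign.                                          *)
Definition transp U V (f : 'Hom(U, V)) (x : dual V) : dual U := (x \o f)%VF.

(* The pairing of t with x (x) y.                                             *)
Definition tpair U V (t : tensor U V) (x : dual U) (y : dual V) : K :=
  tlift (fun u v => x u * y v : K^o) t.

Lemma tpairE U V (u : U) (v : V) (x : dual U) (y : dual V) :
  tpair (pure u v) x y = x u * y v.
Proof.
rewrite /tpair tliftE //; split=> [w|w] c a b /=; rewrite linearP /=.
- by rewrite mulrDl -mulrA.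
- by rewrite mulrDr mulrCA.
Qed.

End Tensor.

Arguments flip {K U V} t.

Record is_poisson (K : fieldType) (V : vectType K)
    (br mu : V -> V -> V) : Prop := IsPoisson {
  br_bilinear : bilinear_for *:%R *:%R br;
  br_alternating : forall a, br a a = 0;
  br_jacobi : forall a b c, br a (br b c) + br b (br c a) + br c (br a b) = 0;
  mu_bilinear : bilinear_for *:%R *:%R mu;
  mu_comm : commutative mu;
  mu_assoc : associative mu;
  br_leibniz : forall a b c, br a (mu b c) = mu (br a b) c + mu b (br a c) }.

Definition poisson_subalgebra (K : fieldType) (V : vectType K)
    (br mu : V -> V -> V) (S : {vspace V}) : Prop :=
  {in S &, forall u v, br u v \in S} /\ {in S &, forall u v, mu u v \in S}.

(* The restriction of op to S, meaningful when S is closed under op.          *)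
Definition sub_op (K : fieldType) (V : vectType K) (op : V -> V -> V)
    (S : {vspace V}) (u v : subvs_of S) : subvs_of S :=
  vsproj S (op (vsval u) (vsval v)).

Definition sum_op (U V : Type) (op : U -> U -> U) (op' : V -> V -> V)
    (p q : U * V) : U * V := (op p.1 q.1, op' p.2 q.2).

Definition poisson_isomorphic (K : fieldType) (V W : vectType K)
    (br mu : V -> V -> V) (br' mu' : W -> W -> W) : Prop :=
  exists f : 'Hom(V, W),
    [/\ bijective f, {morph f : x y / br x y >-> br' x y}
      & {morph f : x y / mu x y >-> mu' x y}].

(* The operation on the dual space that is dual to a cooperation.             *)
Definition dual_op (K : fieldType) (V : vectType K)
    (d : 'Hom(V, tensor V V)) (x y : dual V) : dual V :=
  linfun (fun a => tpair (d a) x y : K^o).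

Lemma dual_opE (K : fieldType) (V : vectType K) (d : 'Hom(V, tensor V V))
  (x y : dual V) a : dual_op d x y a = tpair (d a) x y.
Proof. by rewrite linfunE // => c u v; rewrite /tpair !linearP. Qed.

Section PoissonBialgebra.
Context {K : fieldType} {A : vectType K}.
Variables br mu : A -> A -> A.

Let ad (a : A) : 'End(A) := linfun (br a).
Let L (a : A) : 'End(A) := linfun (mu a).
Let id : 'End(A) := \1%VF.

Record is_poisson_bialgebra (delta Delta : 'Hom(A, tensor A A)) : Prop :=
  IsPoissonBialgebra {
  bialg_poisson : is_poisson br mu;
  bialg_dual_poisson : is_poisson (dual_op delta) (dual_op Delta);
  delta_br : forall a b, delta (br a b) =
    (tmap (ad a) id + tmap id (ad a)) (delta b)
    - (tmap (ad b) id + tmap id (ad b)) (delta a);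
  Delta_mu : forall a b, Delta (mu a b) =
    tmap (L a) id (Delta b) + tmap id (L b) (Delta a);
  delta_mu : forall a b, delta (mu a b) =
    tmap (L a) id (delta b) + tmap (L b) id (delta a)
    + tmap id (ad a) (Delta b) + tmap id (ad b) (Delta a);
  Delta_br : forall a b, Delta (br a b) =
    (tmap (ad a) id + tmap id (ad a)) (Delta b)
    + (tmap (L b) id - tmap id (L b)) (delta a) }.

Variable r : tensor A A.

Definition delta_of : 'Hom(A, tensor A A) :=
  linfun (fun a => (tmap id (ad a) + tmap (ad a) id) r).

Definition Delta_of : 'Hom(A, tensor A A) :=
  linfun (fun a => (tmap id (L a) - tmap (L a) id) r).

(* For r = \sum_i a_i (x) b_i, the two nested tlift amount to the double sum  *)
(* over i and j: see CYB_sum and AYB_sum.                                     *)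
Lemma delta_ofE a :
  is_poisson br mu -> delta_of a = (tmap id (ad a) + tmap (ad a) id) r.
Proof.
case=> bl _ _ _ _ _ _; rewrite linfunE // => c u v /=.
rewrite /ad (linfun_linear bl) !add_lfunE (tmap_linearr _ _ c).
by rewrite (tmap_linearl _ _ c) scalerDr addrACA.
Qed.

Lemma Delta_ofE a :
  is_poisson br mu -> Delta_of a = (tmap id (L a) - tmap (L a) id) r.
Proof.
case=> _ _ _ bl _ _ _; rewrite linfunE // => c u v /=.
rewrite /L (linfun_linear bl) !add_lfunE !opp_lfunE (tmap_linearr _ _ c).
by rewrite (tmap_linearl _ _ c) scalerBr opprD addrACA.
Qed.

Definition CYB : tensor A (tensor A A) :=
  tlift (fun a b => tlift (fun a' b' =>
    pure (br a a') (pure b b') + pure a (pure a' (br b b'))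
    + pure a (pure (br b a') b')) r) r.

Definition AYB : tensor A (tensor A A) :=
  tlift (fun a b => tlift (fun a' b' =>
    pure (mu a a') (pure b b') + pure a (pure a' (mu b b'))
    - pure a (pure (mu a' b) b')) r) r.

Lemma CYB_sum n (a b : 'I_n -> A) :
    is_poisson br mu -> r = \sum_i pure (a i) (b i) ->
  CYB = \sum_i \sum_j
    (pure (br (a i) (a j)) (pure (b i) (b j))
     + pure (a i) (pure (a j) (br (b i) (b j)))
     + pure (a i) (pure (br (b i) (a j)) (b j))).
Proof.
case=> -[bl br'] _ _ _ _ _ _; rewrite /CYB => ->.
have [pl pr] := pure_bilinear A A; have [ql qr] := pure_bilinear A (tensor A A).
by rewrite tlift2_sum // => u v; split=> w c x y;
  rewrite /= !(bl, br', pl, pr, ql, qr)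
    (addrACA (c *: _)) -scalerDr (addrACA (c *: _)) -scalerDr.
Qed.

Lemma AYB_sum n (a b : 'I_n -> A) :
    is_poisson br mu -> r = \sum_i pure (a i) (b i) ->
  AYB = \sum_i \sum_j
    (pure (mu (a i) (a j)) (pure (b i) (b j))
     + pure (a i) (pure (a j) (mu (b i) (b j)))
     - pure (a i) (pure (mu (a j) (b i)) (b j))).
Proof.
case=> _ _ _ [bl br'] _ _ _; rewrite /AYB => ->.
have [pl pr] := pure_bilinear A A; have [ql qr] := pure_bilinear A (tensor A A).
by rewrite tlift2_sum // => u v; split=> w c x y;
  rewrite /= !(bl, br', pl, pr, ql, qr) opprD -scalerN
    (addrACA (c *: _)) -scalerDr (addrACA (c *: _)) -scalerDr.
Qed.

Definition adL_invariant (s : tensor A A) : Prop :=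
  forall a, (tmap (ad a) id + tmap id (ad a)) s = 0
         /\ (tmap (L a) id - tmap id (L a)) s = 0.

Definition sym_part : tensor A A := 2%:R^-1 *: (r + flip r).

Record quasi_triangular : Prop := QuasiTriangular {
  qt_bialgebra : is_poisson_bialgebra delta_of Delta_of;
  qt_CYB : CYB = 0;
  qt_AYB : AYB = 0;
  qt_invariant : adL_invariant sym_part }.

Definition rplus : 'Hom(dual A, A) :=
  linfun (fun x : dual A => tlift (fun a b => x a *: b) r).

Definition rminus : 'Hom(dual A, A) :=
  linfun (fun x : dual A => - tlift (fun a b => x b *: a) r).

Lemma rplusP (x y : dual A) : y (rplus x) = tpair r x y.
Proof.
rewrite linfunE => [|c u v]; last first.
  rewrite /tlift scaler_sumr -big_split /=; apply: eq_bigr => i _.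
  rewrite scaler_sumr -big_split /=; apply: eq_bigr => j _.
  rewrite add_lfunE scale_lfunE !scalerDl !scalerDr -(scalerA c).
  by rewrite [_ *: (c *: _)]scalerA mulrC -scalerA.
rewrite /tpair /tlift linear_sum; apply: eq_bigr => i _ /=.
rewrite linear_sum; apply: eq_bigr => j _.
by rewrite /= [LHS]linearZ; congr (_ *: _); apply: linearZ.
Qed.

Lemma rminusP (x y : dual A) : x (rminus y) = - tpair r x y.
Proof.
rewrite linfunE => [|c u v]; last first.
  rewrite scalerN -opprD; congr (- _).
  rewrite /tlift scaler_sumr -big_split /=; apply: eq_bigr => i _.
  rewrite scaler_sumr -big_split /=; apply: eq_bigr => j _.
  rewrite add_lfunE scale_lfunE !scalerDl !scalerDr -(scalerA c).
  by rewrite [_ *: (c *: _)]scalerA mulrC -scalerA.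
rewrite linearN /=; congr (- _).
rewrite /tpair /tlift linear_sum; apply: eq_bigr => i _ /=.
rewrite linear_sum; apply: eq_bigr => j _.
rewrite /= [LHS]linearZ; congr (_ *: _).
by rewrite [LHS]linearZ; apply: mulrC.
Qed.

Definition Ir : 'Hom(dual A, A) := rplus - rminus.

Definition factorizable : Prop := quasi_triangular /\ bijective Ir.

Definition br_r (x y : dual A) : dual A :=
  - transp (ad (rplus x)) y + transp (ad (rminus y)) x.

Definition mu_r (x y : dual A) : dual A :=
  transp (L (rplus x)) y + transp (L (rminus y)) x.

Definition rplus_rminus : 'Hom(dual A, (A * A)%type) :=
  linfun (fun x => (rplus x, rminus x)).

Lemma rplus_rminusE x : rplus_rminus x = (rplus x, rminus x).
Proof. by rewrite linfunE // => c u v; rewrite !linearP. Qed.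

End PoissonBialgebra.

(* Main.v *)
Require Import Defs.
From HB Require Import structures.
From mathcomp Require Import all_boot all_order all_algebra ring.
Set Implicit Arguments.
Unset Strict Implicit.
Unset Printing Implicit Defensive.

Import GRing.Theory.
Local Open Scope ring_scope.

(** Pairing [C(r) = 0] and [A(r) = 0] with [x (x) y (x) z] gives identities
    between the values of [x], [y], [z] on products of values of [r_+] and
    [r_-]. Since [z (r_+ w) = - w (r_- z)], they say that [r_+] and [r_-] are
    both morphisms from [(A^*, [ , ]_r, ._r)] to [A]: the identity at
    [(x, y, z)] gives it for [r_+], the one at [(z, x, y)] for [r_-]. Hence the
    image of [r_+ (+) r_-] is a subalgebra. Finally [r_+ (+) r_-] is injective,
    and the decomposition exists and is unique, because
    [r_+ - r_- = I_r] is bijective. *)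

(** * Finite sums of pure tensors and bilinear expansions *)

Section Tensors.
Context {K : fieldType} {U V W : vectType K}.

(** Grouping the coefficients of [t] by rows leaves one pure tensor per basis vector of [U]. This
    supplies the form of [r] on which [CYB_sum] and [AYB_sum] apply. *)
Lemma tensor_sum_pure (t : tensor U V) :
  exists n (a : 'I_n -> U) (b : 'I_n -> V), t = \sum_i pure (a i) (b i).
Proof.
exists (\dim {:U}), (fun i => (vbasis {:U})`_i),
  (fun i => \sum_j t i j *: (vbasis {:V})`_j).
rewrite -[LHS]tlift_pure; apply: eq_bigr => i _.
have [_ pr] := pure_bilinear U V.
pose p : {linear V -> tensor U V} :=
  HB.pack (pure (vbasis {:U})`_i)
    (GRing.isLinear.Build _ _ _ _ _ (pr (vbasis {:U})`_i)).
rewrite -[RHS]/(p _) linear_sum; apply: eq_bigr => j _.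
by rewrite linearZ.
Qed.

Lemma bilinear_sum (f : U -> V -> W) :
    bilinear_for *:%R *:%R f ->
  forall n (c d : 'I_n -> K) (u : 'I_n -> U) (v : 'I_n -> V),
  f (\sum_i c i *: u i) (\sum_j d j *: v j)
    = \sum_i \sum_j (c i * d j) *: f (u i) (v j).
Proof.
move=> [fl fr] n c d u v.
pose gl y : {linear U -> W} :=
  HB.pack (f^~ y) (GRing.isLinear.Build _ _ _ _ (f^~ y) (fl y)).
pose gr x : {linear V -> W} :=
  HB.pack (f x) (GRing.isLinear.Build _ _ _ _ (f x) (fr x)).
rewrite -[LHS]/(gl _ _) linear_sum; apply: eq_bigr => i _.
rewrite linearZ /= -[f _ _]/(gr _ _) linear_sum scaler_sumr.
by apply: eq_bigr => j _; rewrite linearZ scalerA.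
Qed.

Lemma tpair_tmap {U' V' : vectType K} (f : 'Hom(U, U')) (g : 'Hom(V, V'))
    (t : tensor U V) (x : dual U') (y : dual V') :
  tpair (tmap f g t) x y = tpair t (transp f x) (transp g y).
Proof.
have [n [a [b ->]]] := tensor_sum_pure t.
rewrite /tpair !linear_sum; apply: eq_bigr => i _.
by rewrite /= tmapE -!/(tpair _ _ _) !tpairE !comp_lfunE.
Qed.

Lemma dual_bilinear_sum (f : U -> V -> W) (x : dual W) :
    bilinear_for *:%R *:%R f ->
  forall n (c d : 'I_n -> K) (u : 'I_n -> U) (v : 'I_n -> V),
  x (f (\sum_i c i *: u i) (\sum_j d j *: v j))
    = \sum_i \sum_j c i * d j * x (f (u i) (v j)) :> K.
Proof.
move=> fb n c d u v; rewrite bilinear_sum // linear_sum; apply: eq_bigr => i _.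
by rewrite linear_sum; apply: eq_bigr => j _; rewrite linearZ.
Qed.

End Tensors.

(** * Pairing of triple tensors with three functionals *)

Section TriplePairing.
Context {K : fieldType} {U V W : vectType K}.
Variables (x : dual U) (y : dual V) (z : dual W).

Definition tpair3 (t : tensor U (tensor V W)) : K^o :=
  tlift (fun u s => x u * tpair s y z : K^o) t.

HB.instance Definition _ :=
  GRing.isLinear.Build K (tensor U (tensor V W)) K^o *:%R tpair3
    (@tlift_linear K _ _ _ _).

Lemma tpair3E u v w : tpair3 (pure u (pure v w)) = x u * (y v * z w).
Proof.
rewrite /tpair3 tliftE ?tpairE //; split=> [s|s] c a b; rewrite /tpair !linearP.
- by rewrite mulrDl -mulrA.
- by rewrite mulrDr mulrCA.
Qed.

Lemma tpair3_sum n (F : 'I_n -> 'I_n -> tensor U (tensor V W)) :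
  tpair3 (\sum_i \sum_j F i j) = \sum_i \sum_j tpair3 (F i j) :> K.
Proof. by rewrite linear_sum; apply: eq_bigr => i _; rewrite linear_sum. Qed.

End TriplePairing.

(** * The Yang-Baxter equations as morphism identities for [rplus] and [rminus] *)

Section Factorizable.
Context {K : fieldType} {A : vectType K}.
Variables (br mu : A -> A -> A) (r : tensor A A).
Implicit Types x y z : dual A.

Let rp := rplus r.
Let rm := rminus r.

(** Coordinate functionals already separate points. Equalities in [A] can thus be tested against
    functionals, where [rplus] and [rminus] are transposes up to sign. *)
Lemma dual_ext u v : (forall x : dual A, x u = x v) -> u = v.
Proof.
move=> uv; rewrite (coord_vbasis (memvf u)) (coord_vbasis (memvf v)).
apply: eq_bigr => i _; congr (_ *: _).
by have := uv (linfun (coord (vbasis {:A}) i : A -> K^o)); rewrite !lfunE.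
Qed.

Lemma rplus_rminusC x y : x (rp y) = - y (rm x).
Proof. by rewrite rplusP rminusP opprK. Qed.

Lemma rplus_sum n (a b : 'I_n -> A) x :
  r = \sum_i pure (a i) (b i) -> rp x = \sum_i x (a i) *: b i.
Proof.
move=> rE; apply: dual_ext => y; rewrite rplusP rE /tpair !linear_sum.
by apply: eq_bigr => i _; rewrite linearZ /= -/(tpair _ _ _) tpairE.
Qed.

Lemma rminus_sum n (a b : 'I_n -> A) x :
  r = \sum_i pure (a i) (b i) -> rm x = \sum_i (- x (b i)) *: a i.
Proof.
move=> rE; apply: dual_ext => y; rewrite rminusP rE /tpair !linear_sum.
rewrite -sumrN; apply: eq_bigr => i _.
by rewrite linearZ /= -/(tpair _ _ _) tpairE [RHS]mulNr mulrC.
Qed.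

(** A functional evaluated on a leg [a i] contracts [r] to a value of [rp], and on a leg [b i] to
    minus a value of [rm]. The first term of [CYB] has two such signs, which cancel; the middle-slot
    term has a single one. *)
Lemma tpair3_CYB x y z : is_poisson br mu ->
  tpair3 x y z (CYB br r)
    = x (br (rm y) (rm z)) + z (br (rp x) (rp y)) - y (br (rp x) (rm z)) :> K.
Proof.
move=> P; have brb := br_bilinear P.
have [n [a [b rE]]] := tensor_sum_pure r.
rewrite (CYB_sum P rE) !(rplus_sum _ rE) !(rminus_sum _ rE) tpair3_sum.
rewrite !dual_bilinear_sum // -big_split -sumrB; apply: eq_bigr => i _ /=.
rewrite -big_split -sumrB; apply: eq_bigr => j _ /=.
by rewrite !linearD /= !tpair3E; ring.
Qed.

(** Same contraction as for [CYB]; here the sign from the single [rm] in the last term cancels the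
    minus in [AYB]. *)
Lemma tpair3_AYB x y z : is_poisson br mu ->
  tpair3 x y z (AYB mu r)
    = x (mu (rm y) (rm z)) + z (mu (rp x) (rp y)) + y (mu (rp x) (rm z)) :> K.
Proof.
move=> P; have mub := mu_bilinear P.
have [n [a [b rE]]] := tensor_sum_pure r.
rewrite (AYB_sum P rE) !(rplus_sum _ rE) !(rminus_sum _ rE) tpair3_sum.
rewrite !dual_bilinear_sum // -!big_split; apply: eq_bigr => i _ /=.
rewrite -!big_split; apply: eq_bigr => j _ /=; rewrite (mu_comm P (a j)).
by rewrite linearB linearD /= !tpair3E; ring.
Qed.

Lemma br_rE x y a : is_poisson br mu ->
  br_r br r x y a = x (br (rm y) a) - y (br (rp x) a).
Proof.
move=> P; have [_ brr] := br_bilinear P.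
rewrite add_lfunE opp_lfunE !comp_lfunE !(linfunE (brr _)) addrC //.
Qed.

Lemma mu_rE x y a : is_poisson br mu ->
  mu_r mu r x y a = x (mu (rm y) a) + y (mu (rp x) a).
Proof.
move=> P; have [_ mur] := mu_bilinear P.
by rewrite add_lfunE !comp_lfunE !(linfunE (mur _)) addrC.
Qed.

Lemma br_alternatingC a b : is_poisson br mu -> br a b = - br b a.
Proof.
move=> P; have [brl brr] := br_bilinear P; have alt := br_alternating P.
(* The scalar [1] gives the sum the shape [c *: u + v] in which bilinearity is stated. *)
have := alt (1 *: a + b); rewrite brl !brr /= !alt scaler0 !scale1r add0r.
by rewrite addr0 => /eqP; rewrite addr_eq0 => /eqP.
Qed.

(** Transposition moves [ad a] onto one functional, and pairing with [r] becomes evaluation at a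
    bracket of [a] with [rp x] or [rm y]. Antisymmetry then moves [a] to the right slot. *)
Lemma dual_op_delta_of x y : is_poisson br mu ->
  dual_op (delta_of br r) x y = br_r br r x y.
Proof.
move=> P; apply/lfunP => a; have [_ brr] := br_bilinear P.
rewrite dual_opE (delta_ofE _ _ P) br_rE // add_lfunE /tpair linearD /=.
rewrite -!/(tpair _ _ _) !tpair_tmap -(rplusP r) -[X in _ + X]opprK -rminusP.
rewrite !comp_lfunE ![transp \1 _]comp_lfun1r !(linfunE (brr _)).
by rewrite 2!(br_alternatingC a _ P) !linearN opprK addrC.
Qed.

Lemma dual_op_Delta_of x y : is_poisson br mu ->
  dual_op (Delta_of mu r) x y = mu_r mu r x y.
Proof.
move=> P; apply/lfunP => a; have [_ mur] := mu_bilinear P.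
rewrite dual_opE (Delta_ofE _ _ P) mu_rE // add_lfunE opp_lfunE /tpair linearB.
rewrite /= -!/(tpair _ _ _) !tpair_tmap -(rplusP r)  -[tpair r _ _]opprK
  -rminusP opprK.
rewrite !comp_lfunE ![transp \1 _]comp_lfun1r !(linfunE (mur _)).
by rewrite 2!(mu_comm P a) addrC.
Qed.

(** The bialgebra already contains a Poisson structure on the dual. Its operations agree with [br_r]
    and [mu_r] pointwise, so each axiom is transported by rewriting. *)
Lemma is_poisson_r :
  quasi_triangular br mu r -> is_poisson (br_r br r) (mu_r mu r).
Proof.
case=> -[P D _ _ _ _] _ _ _.
have brE : dual_op (delta_of br r) =2 br_r br r.
  by move=> x y; apply: dual_op_delta_of.
have muE : dual_op (Delta_of mu r) =2 mu_r mu r.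
  by move=> x y; apply: dual_op_Delta_of.
case: D => [[bl1 bl2] alt jac [ml1 ml2] mC mA leib].
split.
- by split=> [v|u] c x y; rewrite /= -!brE ?bl1 ?bl2.
- by move=> a; rewrite -brE.
- by move=> a b c; rewrite -!brE.
- by split=> [v|u] c x y; rewrite /= -!muE ?ml1 ?ml2.
- by move=> a b; rewrite -!muE.
- by move=> a b c; rewrite -!muE.
- by move=> a b c; rewrite -!muE -!brE.
Qed.

Hypotheses (P : is_poisson br mu) (C0 : CYB br r = 0) (A0 : AYB mu r = 0).

Lemma rplus_br x y : rp (br_r br r x y) = br (rp x) (rp y).
Proof.
apply: dual_ext => z; rewrite rplus_rminusC br_rE // opprB.
have /eqP := tpair3_CYB x y z P; rewrite C0 linear0 eq_sym subr_eq0 => /eqP <-.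
by rewrite addrAC subrr add0r.
Qed.

Lemma rminus_br x y : rm (br_r br r x y) = br (rm x) (rm y).
Proof.
apply: dual_ext => z; rewrite -[LHS]opprK -rplus_rminusC br_rE // opprB.
have /eqP := tpair3_CYB z x y P; rewrite C0 linear0 eq_sym subr_eq0.
(* The identity has [rp z] in the left slot, whereas evaluating [br_r] at [rp z] puts it in the
   right one. *)
rewrite !(br_alternatingC (rp z) _ P) !linearN /= subr_eq => /eqP ->.
by rewrite addrC.
Qed.

Lemma rplus_mu x y : rp (mu_r mu r x y) = mu (rp x) (rp y).
Proof.
apply: dual_ext => z; rewrite rplus_rminusC mu_rE //.
have /eqP := tpair3_AYB x y z P; rewrite A0 linear0 eq_sym addrAC.
by rewrite addr_eq0 => /eqP ->; rewrite opprK.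
Qed.

Lemma rminus_mu x y : rm (mu_r mu r x y) = mu (rm x) (rm y).
Proof.
apply: dual_ext => z; rewrite -[LHS]opprK -rplus_rminusC mu_rE //.
have /eqP := tpair3_AYB z x y P; rewrite A0 linear0 eq_sym -addrA addr_eq0.
by rewrite !(mu_comm P (rp z)) addrC => /eqP ->.
Qed.

Lemma rplus_rminus_br x y :
  rplus_rminus r (br_r br r x y)
    = sum_op br br (rplus_rminus r x) (rplus_rminus r y).
Proof. by rewrite !rplus_rminusE -/rp -/rm rplus_br rminus_br. Qed.

Lemma rplus_rminus_mu x y :
  rplus_rminus r (mu_r mu r x y)
    = sum_op mu mu (rplus_rminus r x) (rplus_rminus r y).
Proof. by rewrite !rplus_rminusE -/rp -/rm rplus_mu rminus_mu. Qed.

End Factorizable.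

(** * The image of an injective morphism *)

Section Image.
Context {K : fieldType} {V W : vectType K}.
Variables (f : 'Hom(V, W)) (opV : V -> V -> V) (opW : W -> W -> W).
Hypotheses (f_inj : injective f) (fM : {morph f : x y / opV x y >-> opW x y}).

Lemma limg_op_closed : {in limg f &, forall u v, opW u v \in limg f}.
Proof.
move=> u v /memv_imgP[x _ ->] /memv_imgP[y _ ->].
by rewrite -fM memv_img ?memvf.
Qed.

(** The map [f^-1] is defined on all of [W]; after the inclusion of [limg f] it is a genuine inverse
    of the injective [f]. *)
Definition limg_inv : 'Hom(subvs_of (limg f), V) :=
  (f^-1 \o linfun vsval)%VF.

Lemma limg_inv_op :
  {morph limg_inv : u v / sub_op opW u v >-> opV u v}.
Proof.
move=> u v; rewrite !comp_lfunE !lfunE /=.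
have kf : lker f == 0%VS by apply/lker0P.
(* Closure of the image makes the projection inside [sub_op] leave the product unchanged. *)
rewrite /sub_op vsprojK ?limg_op_closed ?subvsP //.
have /memv_imgP[x _ ->] := subvsP u; have /memv_imgP[y _ ->] := subvsP v.
by rewrite -fM !lker0_lfunK.
Qed.

Lemma limg_inv_bij : bijective limg_inv.
Proof.
have kf : lker f == 0%VS by apply/lker0P.
exists (fun x => vsproj (limg f) (f x)) => [u|x]; last first.
  by rewrite comp_lfunE lfunE /= vsprojK ?memv_img ?memvf ?lker0_lfunK.
rewrite comp_lfunE lfunE /= limg_lfunVK ?subvsP //; exact: vsvalK.
Qed.

End Image.

Theorem proposition3p3 (K : fieldType) (charK : [pchar K] =i pred0)
    (A : vectType K) (br mu : A -> A -> A) (r : tensor A A) :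
  factorizable br mu r ->
  let S : {vspace (A * A)%type} := limg (rplus_rminus r) in
  [/\ poisson_subalgebra (sum_op br br) (sum_op mu mu) S,
      is_poisson (br_r br r) (mu_r mu r),
      poisson_isomorphic (sub_op (sum_op br br) (S := S))
        (sub_op (sum_op mu mu) (S := S)) (br_r br r) (mu_r mu r)
    & forall a : A, exists! p : A * A, p \in S /\ a = p.1 - p.2].
Proof.
case=> qt Ibij S; have P := bialg_poisson (qt_bialgebra qt).
have brM := rplus_rminus_br P (qt_CYB qt).
have muM := rplus_rminus_mu P (qt_AYB qt).
have IrE x : Ir r x = (rplus_rminus r x).1 - (rplus_rminus r x).2.
  by rewrite rplus_rminusE add_lfunE opp_lfunE.
have f_inj : injective (rplus_rminus r).
  by move=> x y xy; apply: (bij_inj Ibij); rewrite !IrE xy.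
split.
- by split; [apply: limg_op_closed brM | apply: limg_op_closed muM].
- exact: is_poisson_r.
- exists (limg_inv (rplus_rminus r)); split.
  + exact: limg_inv_bij.
  + exact: limg_inv_op.
  + exact: limg_inv_op.
(* With [g] the inverse of [Ir r], the pair is the image of [g a]. Any other admissible pair comes
   from some [x] with [Ir r x = a], so [x = g a]. *)
- case: (Ibij) => g _ gK a; exists (rplus_rminus r (g a)); split.
    by rewrite -IrE gK memv_img ?memvf.
  move=> _ [/memv_imgP[x _ ->] aE]; congr (rplus_rminus r _).
  by apply: (bij_inj Ibij); rewrite gK [LHS]aE IrE.
Qed.
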